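(* Let $\mathcal{F}$ be a family of bounded linear operators from a Banach space $X$ to a normed linear space $Y$. If $\mathcal{F}$ is pointwise bounded, i.e., $\sup_{T \in \mathcal{F}} \|Tx\| < \infty$ for all $x \in X$, then $\mathcal{F}$ is norm-bounded, i.e., $\sup_{T \in \mathcal{F}} \|T\| < \infty$.
   Context: Normed linear spaces are over the real or complex numbers ($X$ and $Y$ over the same field), and $\|T\|$ denotes the operator norm of a bounded linear operator $T$. *)

(* Defs.v *)
From HB Require Import structures.
From mathcomp Require Export all_boot all_order all_algebra.
From mathcomp Require Export complex.
From mathcomp Require Export all_classical all_reals all_analysis.

Set Implicit Arguments.
Unset Strict Implicit.
Unset Printing Implicit Defensive.

Export Order.TTheory GRing.Theory Num.Theory.
Export numFieldNormedType.Exports.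

Local Open Scope classical_set_scope.
Local Open Scope ring_scope.

Variant scalar_kind : Set := RealScalars | ComplexScalars.

Definition scalar_field (R : realType) (k : scalar_kind) : numFieldType :=
  match k with
  | RealScalars => R
  | ComplexScalars => R[i]
  end.

Definition real_part (R : realType) (k : scalar_kind) :
    scalar_field R k -> R :=
  match k return scalar_field R k -> R with
  | RealScalars => fun z => z
  | ComplexScalars => fun z => complex.Re z
  end.

(* The library norm `|x| of a vector takes its values in the scalar field, so
   over R[i] it is a nonnegative element of R[i]; this is the same norm, seen
   as a real number. *)
Definition rnorm (R : realType) (k : scalar_kind)
    (V : normedModType (scalar_field R k)) (x : V) : R :=
  real_part `|x|.

Definition bounded_operator (R : realType) (k : scalar_kind)
    (X Y : normedModType (scalar_field R k)) (T : {linear X -> Y}) : Prop :=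
  exists M : R, forall x : X, rnorm (T x) <= M * rnorm x.

(* The supremum is taken in the extended reals; it is finite exactly when T is
   bounded. *)
Definition operator_norm (R : realType) (k : scalar_kind)
    (X Y : normedModType (scalar_field R k)) (T : {linear X -> Y}) : \bar R :=
  ereal_sup [set (rnorm (T x))%:E | x in [set x : X | rnorm x <= 1]].

(* The supremum over an empty family is -oo, which counts as < +oo. *)
Definition pointwise_norm_bounded (R : realType) (k : scalar_kind)
    (X Y : normedModType (scalar_field R k)) (F : set {linear X -> Y}) : Prop :=
  forall x : X, (ereal_sup [set (rnorm (T x))%:E | T in F] < +oo)%E.

Definition norm_bounded (R : realType) (k : scalar_kind)
    (X Y : normedModType (scalar_field R k)) (F : set {linear X -> Y}) : Prop :=
  (ereal_sup [set operator_norm T | T in F] < +oo)%E.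

(* Main.v *)
Require Import Defs.
From mathcomp Require Import lra.

Set Implicit Arguments.
Unset Strict Implicit.
Unset Printing Implicit Defensive.

(** The proof is Sokal's gliding-hump argument, which replaces the Baire category
    theorem by one elementary remark: since T v is half the difference of
    T (x + v) and T (x - v), one of these two vectors is at least as long as T v.
    Hence on every ball of radius r, wherever its centre x lies, T reaches
    norms close to r * ||T|| (operator_norm_jump).

    Suppose that the operator norms of the family are unbounded, and choose T_n
    in it with ||T_n|| > 6 * 3^n * n.  Starting from x_0 = 0, the remark
    gives x_(n+1) within 3^-n of x_n with ||T_n x_(n+1)|| >= 2/3 * 3^-n * ||T_n||.
    By completeness the x_n converge to some l, and the remaining steps move
    x_(n+1) by at most 1/2 * 3^-n in total (geometric_cvg).  As 1/2 < 2/3,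
    the later steps cannot undo what was gained at step n:
    ||T_n l|| >= (2/3 - 1/2) * 3^-n * ||T_n|| > n for every n, which contradicts
    pointwise boundedness at l.

    The argument uses only real multiples of vectors and real values of norms,
    so both scalar fields are treated at once: real_scalar embeds the reals into
    either of them. *)

Local Open Scope classical_set_scope.
Local Open Scope ring_scope.

Definition real_scalar (R : realType) (k : scalar_kind) :
    R -> scalar_field R k :=
  match k return R -> scalar_field R k with
  | RealScalars => fun a => a
  | ComplexScalars => fun a => (a%:C)%C
  end.

Lemma real_scalarD (R : realType) k (a b : R) :
  real_scalar k (a + b) = real_scalar k a + real_scalar k b.
Proof. by case: k => //=; rewrite rmorphD. Qed.

Lemma real_scalarM (R : realType) k (a b : R) :
  real_scalar k (a * b) = real_scalar k a * real_scalar k b.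
Proof. by case: k => //=; rewrite rmorphM. Qed.

Lemma real_scalar_norm (R : realType) k (a : R) :
  `|real_scalar k a| = real_scalar k `|a|.
Proof. by case: k => //=; rewrite normc_def /= expr0n /= addr0 sqrtr_sqr. Qed.

Lemma real_scalar_le (R : realType) k (a b : R) :
  (real_scalar k a <= real_scalar k b) = (a <= b).
Proof. by case: k => //=; rewrite lecE /= eqxx. Qed.

Lemma real_scalar_lt (R : realType) k (a b : R) :
  (real_scalar k a < real_scalar k b) = (a < b).
Proof. by case: k => //=; rewrite ltcE /= eqxx. Qed.

Lemma real_scalar_inj (R : realType) k : injective (@real_scalar R k).
Proof. by case: k => //= a b []. Qed.

Lemma real_scalarK (R : realType) k (z : scalar_field R k) :
  0 <= z -> real_scalar k (real_part z) = z.
Proof.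
case: k z => //= -[a b]; rewrite lecE /= => /andP[/eqP -> _] //.
Qed.

Lemma real_scalar0 (R : realType) k : real_scalar k (0 : R) = 0.
Proof. by case: k. Qed.

Section real_valued_norm.
Variables (R : realType) (k : scalar_kind).
Variable V : normedModType (scalar_field R k).
Implicit Types x y : V.

(** This equation transports every norm inequality of the library to rnorm, by
    monotonicity or injectivity of real_scalar. *)
Lemma rnormE x : real_scalar k (rnorm x) = `|x|.
Proof. exact: real_scalarK. Qed.

Lemma rnorm_ge0 x : 0 <= rnorm x.
Proof. by rewrite -(real_scalar_le k) real_scalar0 rnormE. Qed.

Lemma rnorm0 : rnorm (0 : V) = 0.
Proof. by apply: (@real_scalar_inj R k); rewrite rnormE normr0 real_scalar0. Qed.

Lemma rnorm_gt0 x : x != 0 -> 0 < rnorm x.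
Proof.
by move=> x0; rewrite -(real_scalar_lt k) real_scalar0 rnormE normr_gt0.
Qed.

Lemma rnormD x y : rnorm (x + y) <= rnorm x + rnorm y.
Proof. by rewrite -(real_scalar_le k) real_scalarD !rnormE ler_normD. Qed.

Lemma rnormN x : rnorm (- x) = rnorm x.
Proof. by rewrite /rnorm normrN. Qed.

Lemma rnormZ (a : R) x : rnorm (real_scalar k a *: x) = `|a| * rnorm x.
Proof.
apply: (@real_scalar_inj R k).
by rewrite real_scalarM !rnormE normrZ real_scalar_norm.
Qed.

Lemma ler_rnorm_distD x y z :
  rnorm (x - z) <= rnorm (x - y) + rnorm (y - z).
Proof. by rewrite -[x - z](subrKA y) rnormD. Qed.

End real_valued_norm.

Lemma geometric_steps_dist (R : realType) k
    (V : normedModType (scalar_field R k)) (x : nat -> V) :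
  (forall n, rnorm (x n.+1 - x n) <= 3^-1 ^+ n) ->
  forall n m, rnorm (x (m + n)%N - x n) <= 3 / 2 * 3^-1 ^+ n.
Proof.
move=> xS n m.
(* The sum of 3^-i for n <= i < m + n, in closed form; the weaker bound of the
   conclusion is not inductive in m. *)
suff : rnorm (x (m + n)%N - x n) <= 3 / 2 * (3^-1 ^+ n - 3^-1 ^+ (m + n)).
  have : 0 < 3^-1 ^+ (m + n) :> R by rewrite exprn_gt0.
  lra.
elim: m => [|m IH]; first by rewrite add0n !subrr rnorm0 mulr0.
have := ler_rnorm_distD (x (m.+1 + n)%N) (x (m + n)%N) (x n).
have := xS (m + n)%N; rewrite -addSn exprS; lra.
Qed.

(** The tails of the geometric series bound both the Cauchy modulus and the
    distance to the limit. *)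
Lemma geometric_cvg (R : realType) k
    (V : completeNormedModType (scalar_field R k)) (x : nat -> V) :
  (forall n, rnorm (x n.+1 - x n) <= 3^-1 ^+ n) ->
  exists l, forall n, rnorm (l - x n) <= 3 / 2 * 3^-1 ^+ n.
Proof.
move=> /geometric_steps_dist xmn.
have : cvg (x @ \oo).
  apply: cauchy_cvg; apply: cauchy_exP => e e0.
  have re0 : 0 < real_part e.
    by rewrite -(real_scalar_lt k) real_scalar0 real_scalarK// ltW.
  have /cvgrPdist_lt/(_ _ re0) :
      (fun n => 3 / 2 * 3^-1 ^+ n : R) @ \oo --> (3 / 2 * 0 : R).
    apply: cvgMl_tmp; apply: cvg_expr; rewrite ger0_norm//; lra.
  case=> N _ /(_ N (leqnn N)); rewrite /= mulr0 sub0r normrN => HN.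
  exists (x N), N => // m /= /subnK Nm.
  rewrite -ball_normE /= -(real_scalarK (ltW e0)) distrC -rnormE real_scalar_lt.
  rewrite -Nm; apply: le_lt_trans (xmn _ _) _.
  exact: le_lt_trans (ler_norm _) HN.
move/cvg_ex => [l /= xl]; exists l => n.
apply/ler_addgt0Pr => e e0.
have e0' : 0 < real_scalar k e by rewrite -(real_scalar0 R k) real_scalar_lt.
have /cvgrPdist_lt/(_ _ e0')[N _ /(_ (N + n)%N (leq_addr _ _))] /= := xl.
rewrite -rnormE real_scalar_lt => lN.
have := ler_rnorm_distD l (x (N + n)%N) (x n).
have := xmn n N; lra.
Qed.

Section operators.
Variables (R : realType) (k : scalar_kind).
Variables X Y : normedModType (scalar_field R k).
Implicit Type T : {linear X -> Y}.

(** Boundedness makes the supremum a real number; rescaling x to norm 1 then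
    shows that this number is a Lipschitz constant of T at 0. *)
Lemma bounded_operator_norm T : bounded_operator T ->
  exists2 t : R, operator_norm T = t%:E &
    forall x, rnorm (T x) <= t * rnorm x.
Proof.
move=> [M TM].
have ub x : rnorm x <= 1 -> ((rnorm (T x))%:E <= operator_norm T)%E.
  by move=> x1; apply: ereal_sup_ubound; exists x.
have fin : operator_norm T \is a fin_num.
  rewrite ge0_fin_numE; last first.
    by apply: le_trans (ub 0 _); rewrite ?rnorm0// lee_fin rnorm_ge0.
  apply: (@le_lt_trans _ _ `|M|%:E); last exact: ltry.
  apply: ge_ereal_sup => _ [x /= x1 <-]; rewrite lee_fin.
  apply: le_trans (TM x) _; apply: le_trans (ler_norm _) _.
  by rewrite normrM (ger0_norm (rnorm_ge0 x)) ler_piMr.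
exists (fine (operator_norm T)); first by rewrite fineK.
move=> x; have [->|/rnorm_gt0 x0] := eqVneq x 0.
  by rewrite linear0 !rnorm0 mulr0.
have := ub (real_scalar k (rnorm x)^-1 *: x).
rewrite linearZ !rnormZ -(fineK fin) lee_fin gtr0_norm ?invr_gt0//.
by rewrite mulVf ?gt_eqF// lexx mulrC ler_pdivrMr// => /(_ isT).
Qed.

(** The supremum need not be attained on the unit ball, so a vector u of the unit
    ball with ||T u|| > 2/3 * t is taken and scaled to v = r u; then x' is x + v
    or x - v, because 2 T v = T (x + v) - T (x - v). Any constant strictly
    between 1/2 and 1 would serve in place of 2/3, 1/2 being what the steps
    after the jump can cost. *)
Lemma operator_norm_jump T (t r : R) (x : X) :
  operator_norm T = t%:E -> 0 < t -> 0 < r ->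
  exists x', rnorm (x' - x) <= r /\ 2 / 3 * t * r <= rnorm (T x').
Proof.
move=> Tt t0 r0.
have : ((2 / 3 * t)%:E < operator_norm T)%E by rewrite Tt lte_fin; lra.
move=> /ereal_sup_gt[_ [u /= u1 <-]]; rewrite lte_fin => Tu.
pose v := real_scalar k r *: u.
have vr : rnorm v <= r by rewrite rnormZ gtr0_norm// ger_pMr.
have Tv : 2 / 3 * t * r <= rnorm (T v).
  by rewrite linearZ rnormZ gtr0_norm// mulrC ler_pM2l// ltW.
have TvD : rnorm (T v) *+ 2 <= rnorm (T (x + v)) + rnorm (T (x - v)).
  have -> : rnorm (T v) *+ 2 = rnorm (T (x + v) - T (x - v)).
    rewrite -linearB opprB addrC subrKA linearD.
    rewrite -mulr2n /rnorm normrMn.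
    by case: (k) (`|T v|) => //= z; rewrite raddfMn.
  by rewrite -(rnormN (T (x - v))) rnormD.
have [h|h] := lerP (rnorm (T v)) (rnorm (T (x + v))).
  exists (x + v); rewrite addrAC subrr add0r; split => //.
  exact: le_trans Tv h.
exists (x - v); rewrite addrAC subrr add0r rnormN; split => //.
by apply: le_trans Tv _; rewrite mulr2n in TvD; lra.
Qed.

End operators.

Theorem mainTheorem1 (R : realType) (k : scalar_kind)
    (X : completeNormedModType (scalar_field R k))
    (Y : normedModType (scalar_field R k))
    (F : set {linear X -> Y})
    (F_bounded : forall T : {linear X -> Y}, F T -> bounded_operator T) :
  pointwise_norm_bounded F -> norm_bounded F.
Proof.
move=> F_pointwise; rewrite /norm_bounded ltNge leye_eq; apply/negP => /eqP supF.
have unbounded n : exists Tt : {linear X -> Y} * R,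
    [/\ F Tt.1, operator_norm Tt.1 = Tt.2%:E,
        6 * 3 ^+ n * n%:R < Tt.2, 0 < Tt.2
      & forall x, rnorm (Tt.1 x) <= Tt.2 * rnorm x].
  have : ((6 * 3 ^+ n * n%:R)%:E <
      ereal_sup [set @operator_norm R k X Y T | T in F])%E.
    by rewrite supF ltry.
  move=> /ereal_sup_gt[_ [T FT <-]].
  have [t Tt Tle] := bounded_operator_norm (F_bounded T FT).
  rewrite Tt lte_fin => nt; exists (T, t); split => //=.
  by apply: le_lt_trans nt; rewrite mulr_ge0// mulr_ge0// exprn_ge0.
have [Tt /all_and5[FT Tnorm tbig t0 Tle]] := choice unbounded.
(* Each jump is made from the point reached by the previous ones: the pair nx
   holds the stage and that point. *)
have step (nx : nat * X) : exists x', rnorm (x' - nx.2) <= 3^-1 ^+ nx.1 /\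
    2 / 3 * (Tt nx.1).2 * 3^-1 ^+ nx.1 <= rnorm ((Tt nx.1).1 x').
  by apply: operator_norm_jump => //; rewrite exprn_gt0.
have [next nextP] := choice step.
pose fix x n := if n is m.+1 then next (m, x m) else 0.
have [l xl] : exists l, forall n, rnorm (l - x n) <= 3 / 2 * 3^-1 ^+ n.
  by apply: geometric_cvg => n; exact: (nextP (n, x n)).1.
(* The tail from x n.+1 costs t * 3/2 * 3^-(n+1) = t/2 * 3^-n, less than the
   2/3 * t * 3^-n gained by the jump. *)
have Tl n : n%:R < rnorm ((Tt n).1 l).
  have [/= _ hit] := nextP (n, x n); rewrite -[next _]/(x n.+1) in hit.
  have tail := le_trans (Tle n _) (ler_wpM2l (ltW (t0 n)) (xl n.+1)).
  have := rnormD ((Tt n).1 l) (- (Tt n).1 (l - x n.+1)).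
  rewrite rnormN linearB opprB addrC subrK => tri.
  have : n%:R < 6^-1 * 3^-1 ^+ n * (Tt n).2.
    by rewrite exprVn -invfM ltr_pdivlMl ?mulr_gt0 ?exprn_gt0.
  move: tail; rewrite linearB exprS; lra.
have [M lM] : exists M : R, forall n, rnorm ((Tt n).1 l) <= M.
  have := F_pointwise l; set s := ereal_sup _ => sfin.
  have Ts n : ((rnorm ((Tt n).1 l))%:E <= s)%E.
    by apply: ereal_sup_ubound; exists (Tt n).1.
  have sfin' : s \is a fin_num.
    rewrite ge0_fin_numE//; apply: le_trans (Ts 0%N).
    by rewrite lee_fin rnorm_ge0.
  by exists (fine s) => n; rewrite -lee_fin fineK.
have := le_lt_trans (lM (Num.truncn M).+1) (truncnS_gt M).
by rewrite ltNge ltW.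
Qed.
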